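(* Let $q\ge 5$ be a prime power, and let $k\ge 1$ and $n\ge 5$ be integers such that $n\le q$ and $k\le n-4$. Let $\zeta=(\zeta_0,\dots,\zeta_{n-1})$ be an $n$-tuple of distinct elements of $\mathbb F_q$ and $\mathbf v=(v_0,\dots,v_{n-1})$ an $n$-tuple of nonzero elements of $\mathbb F_q$. Then, for every integer $t$ with $1\le t\le n-k-1$, there exists an asymmetric quantum convolutional code with parameters $[(n,\ n-t-k-1,\ \mu^*;\ 2,\ (d_z)_f/(d_x)_f)]_q$, for some memory $\mu^*$, where $(d_z)_f\ge t+2$ and $(d_x)_f\ge k+1$ (with these two lower bounds interchanged if $k+1>t+2$).
   Context: Convolutional notions. A matrix over $\mathbb F_q[D]$ is basic if it has a polynomial right inverse. The weight of $\mathbf v(D)\in\mathbb F_q[D]^n$ is the total number of nonzero coefficients of its $n$ components. The Euclidean dual of a submodule $V\subseteq\mathbb F_q[D]^n$ is $V^\perp=\{\mathbf u(D)\in\mathbb F_q[D]^n:\ \mathbf u(D)\mathbf v(1/D)^t=0\ \text{for all }\mathbf v(D)\in V\}$ (the superscript $t$ on vectors and matrices denotes transpose). Asymmetric quantum convolutional code (AQCC), CSS type. It is specified by a basic (hence full-rank) stabilizer matrix $$S(D)=\begin{pmatrix}A(D)&|&0\\0&|&B(D)\end{pmatrix},\quad A\in\mathbb F_q[D]^{r\times n},\ B\in\mathbb F_q[D]^{s\times n},\quad A(D)B(1/D)^t=0$$ (symplectic orthogonality). Let $\mathcal A,\mathcal B\subseteq\mathbb F_q[D]^n$ be the row modules of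 $A$ and $B$; then $\mathcal A\subseteq\mathcal B^\perp$ and $\mathcal B\subseteq\mathcal A^\perp$. The code has parameters $[(n,K,\mu^*;\gamma,(d_z)_f/(d_x)_f)]_q$, where: $n$ is the frame size; $K=n-r-s$ is the number of logical qudits per frame; $\mu^*$ is the memory, i.e. the maximal degree of an entry of $S(D)$; $\gamma$ is the degree, i.e. the overall constraint length (sum over the rows of $S(D)$ of the maximal degree in the row), required to be minimal among all basic matrices with the same row module; and, with $\operatorname{wt}(T)$ denoting the minimum weight of an element of $T$ (equal to $+\infty$ if $T$ is empty), $(d_z)_f$ and $(d_x)_f$ are respectively the maximum and the minimum of the two numbers $\operatorname{wt}(\mathcal B^\perp\setminus\mathcal A)$ and $\operatorname{wt}(\mathcal A^\perp\setminus\mathcal B)$. Convention: whenever the value (bound) given for $(d_x)_f$ is larger than the one given for $(d_z)_f$, the two are interchanged. Writing $\mu^*$ means that no claim is made about the value of the memory. The tuples $\zeta,\mathbf v$ are the data of the generalized Reed–Solomon code $\operatorname{GRS}_k(\zeta,\mathbf v)=\{(v_0f(\zeta_0),\dots,v_{n-1}f(\zeta_{n-1})): f\in\mathbb F_q[x],\ \deg f<k\}$; they do not enter the parameters of the asserted code. *)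

(* Defs.v *)
From HB Require Import structures.
From mathcomp Require Import all_boot all_order all_algebra.
From mathcomp Require Import boolp constructive_ereal.

Set Implicit Arguments.
Unset Strict Implicit.
Unset Printing Implicit Defensive.

Import Order.TTheory GRing.Theory Num.Theory.
Local Open Scope ring_scope.

(* F[D] is {poly F}, with 'X for D; a submodule of F[D]^n is given
   by its membership predicate on row vectors. *)

Section Convolutional.
Variable F : finFieldType.

(* p(1/D), computed in the field F(D), which contains F[D, 1/D]. *)
Definition recip (p : {poly F}) : {fraction {poly F}} :=
  (map_poly (@tofrac {poly F} \o polyC) p).[(@tofrac {poly F} 'X)^-1].

(* U(D) V(1/D)^t *)
Definition mul_recip_tr m p n
    (U : 'M[{poly F}]_(m, n)) (V : 'M[{poly F}]_(p, n)) :
    'M[{fraction {poly F}}]_(m, p) :=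
  map_mx (@tofrac {poly F}) U *m (map_mx recip V)^T.

Definition basic m n (M : 'M[{poly F}]_(m, n)) : Prop :=
  exists N : 'M[{poly F}]_(n, m), M *m N = 1%:M.

Definition row_module m n (M : 'M[{poly F}]_(m, n)) (u : 'rV[{poly F}]_n) : Prop :=
  exists w : 'rV[{poly F}]_m, u = w *m M.

Definition edual n (V : 'rV[{poly F}]_n -> Prop) (u : 'rV[{poly F}]_n) : Prop :=
  forall v, V v -> mul_recip_tr u v = 0.

Definition weight n (v : 'rV[{poly F}]_n) : nat :=
  \sum_(j < n) count (fun c : F => c != 0%R) (v 0%R j).

(* Minimum weight of an element of T, +oo when T is empty. *)
Definition min_weight n (T : 'rV[{poly F}]_n -> Prop) : \bar int :=
  match pselect (exists w, `[< exists2 v, T v & weight v = w >]) with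
  | left exT => ((ex_minn exT)%:Z)%:E
  | right _ => +oo%E
  end.

(* The zero polynomial is given degree 0. *)
Definition row_degree m n (M : 'M[{poly F}]_(m, n)) (i : 'I_m) : nat :=
  \max_(j < n) (size (M i j)).-1.

Definition constraint_length m n (M : 'M[{poly F}]_(m, n)) : nat :=
  \sum_(i < m) row_degree M i.

Definition max_degree m n (M : 'M[{poly F}]_(m, n)) : nat :=
  \max_(i < m) row_degree M i.

Definition css_matrix r s n
    (A : 'M[{poly F}]_(r, n)) (B : 'M[{poly F}]_(s, n)) :
    'M[{poly F}]_(r + s, n + n) :=
  block_mx A 0 0 B.

End Convolutional.

Record aqcc (F : finFieldType) (n : nat) := AQCC {
  aqcc_r : nat;
  aqcc_s : nat;
  aqcc_A : 'M[{poly F}]_(aqcc_r, n);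
  aqcc_B : 'M[{poly F}]_(aqcc_s, n);
  aqcc_basic : basic (css_matrix aqcc_A aqcc_B);
  aqcc_orthogonal : mul_recip_tr aqcc_A aqcc_B = 0;
  aqcc_minimal : forall (m : nat) (M : 'M[{poly F}]_(m, n + n)),
    basic M ->
    (forall u, row_module M u <-> row_module (css_matrix aqcc_A aqcc_B) u) ->
    (constraint_length (css_matrix aqcc_A aqcc_B) <= constraint_length M)%N
}.

Section AqccParams.
Variables (F : finFieldType) (n : nat) (Q : aqcc F n).

Definition aqcc_matrix := css_matrix (aqcc_A Q) (aqcc_B Q).

Definition aqcc_K : int := n%:Z - (aqcc_r Q)%:Z - (aqcc_s Q)%:Z.

Definition aqcc_memory : nat := max_degree aqcc_matrix.

Definition aqcc_degree : nat := constraint_length aqcc_matrix.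

(* wt(B^perp \ A) *)
Definition aqcc_wtB : \bar int :=
  min_weight (fun u => edual (row_module (aqcc_B Q)) u /\ ~ row_module (aqcc_A Q) u).

(* wt(A^perp \ B) *)
Definition aqcc_wtA : \bar int :=
  min_weight (fun u => edual (row_module (aqcc_A Q)) u /\ ~ row_module (aqcc_B Q) u).

Definition aqcc_dz : \bar int := Order.max aqcc_wtB aqcc_wtA.

Definition aqcc_dx : \bar int := Order.min aqcc_wtB aqcc_wtA.

(* [(n, K, mu; gamma, dz/dx)]_q with q = #|F| *)
Definition aqcc_has_params (K : int) (mu gamma : nat) (dz dx : \bar int) : Prop :=
  [/\ aqcc_K = K, aqcc_memory = mu, aqcc_degree = gamma, aqcc_dz = dz
    & aqcc_dx = dx].

End AqccParams.

(* dz >= bz and dx >= bx, the two bounds being interchanged if bx > bz. *)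
Definition distance_bounds (dz dx : \bar int) (bz bx : nat) : Prop :=
  if (bx <= bz)%N then (bz%:Z%:E <= dz)%E /\ (bx%:Z%:E <= dx)%E
  else (bx%:Z%:E <= dz)%E /\ (bz%:Z%:E <= dx)%E.

(* Main.v *)
(** For a matrix B, the top coefficient of a nonzero u in the dual of its row
    module is orthogonal to the rows of B(0), so the weight of u is at least
    the dual distance of the block code generated by B(0).  Let E_0, ...,
    E_(n-1) be the rows of the n x n GRS matrix whose multipliers make E_l
    orthogonal to GRS_k for l < n - k.  If t + 1 < n - k, take for A a
    constant generator matrix of GRS_k and for B the rows E_0 + D^2 E_(t+1),
    E_1, ..., E_t: then B(0) generates an MDS code of dimension t + 1, and
    both distance bounds hold even for the whole duals minus 0.  The degree 2
    is minimal because right multiplication of the stabilizer matrix by a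
    suitable constant matrix has determinant D^2, while the degree of such a
    determinant is at most the constraint length and does not drop from one
    full-rank basis of the row module to another.  If t + 1 = n - k there are
    no logical qudits; then A = (1, 0, ..., 0, -D) and
    B = (1, 0, ..., 0, D), e_1, ..., e_(n-2) are full duals of each other and
    no weight is constrained. *)

Require Import Defs.
From mathcomp Require Import all_boot all_order all_algebra.
From mathcomp Require Import constructive_ereal.
From mathcomp Require Import boolp zify.
Set Implicit Arguments.
Unset Strict Implicit.
Unset Printing Implicit Defensive.
Import Order.TTheory GRing.Theory Num.Theory.
Local Open Scope ring_scope.

(** * Substituting [1/D] for [D] *)

Lemma recipD (F : finFieldType) (p r : {poly F}) : recip (p + r) = recip p + recip r.
Proof. by rewrite /recip rmorphD hornerD. Qed.

Lemma recipM (F : finFieldType) (p r : {poly F}) : recip (p * r) = recip p * recip r.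
Proof. by rewrite /recip rmorphM hornerM. Qed.

Lemma recipC (F : finFieldType) (c : F) : recip c%:P = tofrac c%:P.
Proof. by rewrite /recip map_polyC hornerC. Qed.

Lemma recip0 (F : finFieldType) : recip (0 : {poly F}) = 0.
Proof. by rewrite recipC tofrac0. Qed.

Lemma recipX (F : finFieldType) : recip ('X : {poly F}) = (tofrac 'X)^-1.
Proof. by rewrite /recip map_polyX hornerX. Qed.

Lemma tofracX_neq0 (F : finFieldType) : tofrac ('X : {poly F}) != 0.
Proof. by rewrite tofrac_eq0 polyX_eq0. Qed.

(** Multiplying by [D^d] clears the denominators and reverses the coefficients, which turns
    identities in the fraction field into polynomial ones. *)
Lemma recip_rev (F : finFieldType) (d : nat) (p : {poly F}) : (size p <= d.+1)%N ->
  recip p * tofrac 'X ^+ d = tofrac (\sum_(j < d.+1) p`_j *: 'X^(d - j)).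
Proof.
move=> sp; rewrite /recip (@horner_coef_wide _ d.+1); last first.
  by rewrite (leq_trans (size_poly _ _)).
rewrite mulr_suml rmorph_sum; apply: eq_bigr => j _ /=.
rewrite coef_map /= -mul_polyC tofracM tofracXn -mulrA; congr (_ * _).
have jd : (j <= d)%N by rewrite -ltnS.
rewrite -[X in _ * _ ^+ X](subnK jd) exprD mulrCA -exprMn mulVf ?tofracX_neq0 //.
by rewrite expr1n mulr1.
Qed.

(** * Pairings, duals and weights *)

Lemma mul_recip_trE (F : finFieldType) m p n (U : 'M[{poly F}]_(m, n))
    (V : 'M[{poly F}]_(p, n)) i l :
  mul_recip_tr U V i l = \sum_j tofrac (U i j) * recip (V l j).
Proof. by rewrite mxE; apply: eq_bigr => j _; rewrite !mxE. Qed.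

Lemma edual_row_module (F : finFieldType) m n (M : 'M[{poly F}]_(m, n)) u :
  edual (row_module M) u -> mul_recip_tr u M = 0.
Proof.
move=> uM; apply/rowP => i.
have /uM/rowP/(_ 0) : row_module M (row i M) by exists (delta_mx 0 i); rewrite rowE.
rewrite !mul_recip_trE !mxE => h; rewrite -[RHS]h; apply: eq_bigr => j _.
by rewrite mxE.
Qed.

Lemma edual_lead_coef (F : finFieldType) m n (M : 'M[{poly F}]_(m, n)) u e :
  edual (row_module M) u -> (forall j, size (u 0%R j) <= e.+1)%N ->
  forall i, \sum_j (u 0 j)`_e * (M i j)`_0 = 0.
Proof.
move=> uM su i; set d := (\max_j (size (M i j)))%N.
have sM j : (size (M i j) <= d.+1)%N.
  by rewrite leqW // (@leq_bigmax _ (fun j => size (M i j)) j).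
have /rowP/(_ i) := edual_row_module uM; rewrite mul_recip_trE mxE.
move/(congr1 ( *%R^~ (tofrac 'X ^+ d))); rewrite /= mul0r mulr_suml.
have -> : \sum_j tofrac (u 0 j) * recip (M i j) * tofrac 'X ^+ d
    = tofrac (\sum_j u 0 j * \sum_(l < d.+1) (M i j)`_l *: 'X^(d - l)).
  by rewrite rmorph_sum; apply: eq_bigr => j _; rewrite -mulrA recip_rev // -tofracM.
(* In degree [e + d] the index [l] picks coefficient [e + l] of [u 0 j], which vanishes by [su]
   unless [l = 0]. *)
move/eqP; rewrite tofrac_eq0 => /eqP/(congr1 (coefp (e + d))).
rewrite /= coef0 coef_sum => h; rewrite -[RHS]h; apply: eq_bigr => j _.
have coefE l : (u 0 j * ((M i j)`_l *: 'X^(d - l)))`_(e + d)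
    = if (e + d < d - l)%N then 0 else (M i j)`_l * (u 0 j)`_(e + d - (d - l)).
  by rewrite -scalerAr coefZ coefMXn; case: ifP => _; rewrite ?mulr0.
rewrite mulr_sumr coef_sum; under [RHS]eq_bigr do rewrite coefE.
rewrite big_ord_recl big1 /= => [|l _].
  by rewrite subn0 ltnNge leq_addl addnK addr0 mulrC.
case: ifP => // _; rewrite [X in _ * X]nth_default ?mulr0 //.
by apply: leq_trans (su j) _; rewrite /bump /=; have := ltn_ord l; lia.
Qed.

Lemma min_weight_ge (F : finFieldType) n (T : 'rV[{poly F}]_n -> Prop) (b : nat) :
  (forall u, T u -> (b <= weight u)%N) -> (b%:Z%:E <= min_weight T)%E.
Proof.
move=> hb; rewrite /min_weight; case: pselect => [exT|_]; last by rewrite leey.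
case: ex_minnP => w /asboolP[u Tu <-] _.
by rewrite lee_fin lez_nat hb.
Qed.

Lemma card_coef_le_weight (F : finFieldType) n (u : 'rV[{poly F}]_n) e :
  (#|[set j | ((u 0 j)`_e != 0)%R]| <= weight u)%N.
Proof.
rewrite -sum1_card big_mkcond /=; apply: leq_sum => j _; rewrite inE.
case: ifP => // ue; rewrite -has_count; apply/hasP; exists (u 0 j)`_e => //.
by rewrite mem_nth // ltnNge; apply: contra ue => ?; rewrite nth_default.
Qed.

(** * Generalized Reed-Solomon codes *)

Section Reed_Solomon.
Variables (F : fieldType) (n : nat) (zeta : 'I_n -> F).
Hypothesis zeta_inj : injective zeta.

(* Evaluate at the polynomial vanishing at all support points but one. *)
Lemma GRS_dual_distance s (x : 'I_n -> F) :
  (forall i : 'I_s, \sum_j x j * zeta j ^+ i = 0) -> (exists j, x j != 0) ->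
  (s < #|[set j | (x j != 0)%R]|)%N.
Proof.
move=> x0 [l xl]; rewrite ltnNge; apply/negP => cs.
pose f := \prod_(j in [set j | x j != 0] :\ l) ('X - (zeta j)%:P).
have sf : (size f <= s)%N.
  by rewrite /f -big_enum size_prod_XsubC -cardE; move: cs; rewrite (cardsD1 l) inE xl.
have fl : f.[zeta l] != 0.
  rewrite horner_prod; apply/prodf_neq0 => j; rewrite !inE hornerXsubC subr_eq0.
  by case/andP=> jl _; rewrite (inj_eq zeta_inj) eq_sym.
have : \sum_j x j * f.[zeta j] = 0.
  under eq_bigr do rewrite (horner_coef_wide _ sf) mulr_sumr.
  rewrite exchange_big big1 //= => i _.
  by under eq_bigr do rewrite mulrCA; rewrite -mulr_sumr x0 mulr0.
rewrite (bigD1 l) //= big1 ?addr0 => [/eqP|j jl].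
  by rewrite mulf_eq0 (negPf xl) (negPf fl).
have [->|xj] := eqVneq (x j) 0; first by rewrite mul0r.
by rewrite horner_prod (bigD1 j) ?inE ?jl //= hornerXsubC subrr mul0r mulr0.
Qed.

Definition GRS_mx (w : 'I_n -> F) : 'M[F]_n := \matrix_(i, j) (w j * zeta j ^+ i).

(** A nonzero vector orthogonal to all rows, rescaled by [w], would have weight above [n]. *)
Lemma GRS_mx_unit (w : 'I_n -> F) : (forall j, w j != 0) -> GRS_mx w \in unitmx.
Proof.
move=> w0; rewrite -unitmx_tr -row_free_unit -kermx_eq0; apply/rowV0P => x /sub_kermxP xw.
apply/eqP; apply/negPn/negP => /rV0Pn[j xj].
have /GRS_dual_distance : forall i : 'I_n, \sum_j (x 0 j * w j) * zeta j ^+ i = 0.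
  move=> i; have /rowP/(_ i) := xw; rewrite !mxE => h; rewrite -[RHS]h; apply: eq_bigr => l _.
  by rewrite !mxE mulrA.
suff h : exists j, x 0 j * w j != 0.
  by move=> /(_ h); rewrite ltnNge (leq_trans (max_card _)) ?card_ord.
by exists j; rewrite mulf_neq0.
Qed.

(** A system of [n - 1] equations in [n] unknowns has a nonzero solution; the distance bound forces
    its weight to be [n], so no multiplier vanishes. *)
Lemma GRS_dual_multipliers : (0 < n)%N -> exists2 w : 'I_n -> F,
  (forall j, w j != 0) & (forall i, (i < n.-1)%N -> \sum_j w j * zeta j ^+ i = 0).
Proof.
move=> n0; pose V : 'M[F]_(n, n.-1) := \matrix_(j, i) zeta j ^+ i.
have : kermx V != 0.
  by rewrite kermx_eq0 -row_leq_rank -ltnNge (leq_ltn_trans (rank_leq_col _)) ?ltn_predL.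
case/rowV0Pn=> x /sub_kermxP xV /rV0Pn x0.
have hx i : (i < n.-1)%N -> \sum_j x 0 j * zeta j ^+ i = 0.
  move=> lti; have /rowP/(_ (Ordinal lti)) := xV; rewrite !mxE => {2}<-.
  by apply: eq_bigr => j _; rewrite !mxE.
exists (x 0) => // j.
have /GRS_dual_distance/(_ x0) : forall i : 'I_n.-1, \sum_j x 0 j * zeta j ^+ i = 0.
  by move=> i; apply: hx.
rewrite prednK // => cs.
have /eqP/setP/(_ j) : [set j | x 0 j != 0] == setT.
  by rewrite eqEcard subsetT cardsT card_ord.
by rewrite !inE.
Qed.

End Reed_Solomon.

Lemma weight_edual_GRS (F : finFieldType) n s (zeta w : 'I_n -> F)
    (M : 'M[{poly F}]_(s, n)) u :
  injective zeta -> (forall j, w j != 0) ->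
  (forall i j, (M i j)`_0 = w j * zeta j ^+ i) ->
  edual (row_module M) u -> u != 0 -> (s < weight u)%N.
Proof.
move=> zeta_inj w0 M0 uM u0.
pose e := (\max_j (size (u 0%R j)))%N.
have /rV0Pn[j /negPf uj] := u0.
have e0 : (0 < e)%N.
  by rewrite (leq_trans _ (@leq_bigmax _ (fun j => size (u 0%R j)) j)) // size_poly_gt0 uj.
have su i : (size (u 0%R i) <= e.-1.+1)%N.
  by rewrite prednK // (@leq_bigmax _ (fun j => size (u 0%R j)) i).
have := edual_lead_coef uM su.
have [l _ /esym sl] : {l | l \in 'I_n & e = size (u 0%R l)}.
  by apply: eq_bigmax_cond; rewrite card_ord; case: (n) j {uj} => // -[].
move=> x0; apply: leq_trans (card_coef_le_weight u e.-1).
(* Here [e.-1] is the top degree of [u]; scaling by the nonzero [w] keeps the support. *)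
have -> : [set j | (u 0 j)`_e.-1 != 0] = [set j | (u 0 j)`_e.-1 * w j != 0].
  by apply/setP => i; rewrite !inE mulf_eq0 (negPf (w0 i)) orbF.
apply: (GRS_dual_distance zeta_inj) => [i|].
  by rewrite -[RHS](x0 i); apply: eq_bigr => i' _; rewrite M0 mulrA.
exists l; rewrite mulf_neq0 // -sl -lead_coefE lead_coef_eq0 -size_poly_gt0 sl //.
Qed.

(** * Row degrees, determinants and minimality *)

Lemma size_poly_row_degree (F : finFieldType) m n (M : 'M[{poly F}]_(m, n)) i j :
  (size (M i j) <= (row_degree M i).+1)%N.
Proof.
apply: leq_trans (leqSpred _) _; rewrite ltnS.
exact: (@leq_bigmax _ (fun j => (size (M i j)).-1) j).
Qed.

(** A constant [N] does not raise row degrees, and each term of the Leibniz expansion takes one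
    factor from each row. *)
Lemma size_det_constraint_length (F : finFieldType) m n (M : 'M[{poly F}]_(m, n))
    (N : 'M[F]_(n, m)) :
  (size (\det (M *m map_mx polyC N)) <= (constraint_length M).+1)%N.
Proof.
apply: leq_trans (size_sum _ _ _) _; apply/bigmax_leqP => s _.
have -> (b : bool) (p : {poly F}) : size ((-1) ^+ b * p) = size p.
  by case: b; rewrite ?expr1 ?expr0 ?mulN1r ?size_polyN ?mul1r.
apply: leq_trans (size_poly_prod_leq _ _) _.
rewrite leq_subLR addnS ltnS -sum1_card -big_split /=.
apply: leq_sum => i _; rewrite add1n mxE.
apply: leq_trans (size_sum _ _ _) _; apply/bigmax_leqP => j _.
rewrite !mxE mulrC mul_polyC; apply: leq_trans (size_scale_leq _ _) _.
exact: size_poly_row_degree.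
Qed.

Lemma row_module_factor (F : finFieldType) m n p (M : 'M[{poly F}]_(m, n))
    (S : 'M[{poly F}]_(p, n)) :
  (forall u, row_module M u -> row_module S u) -> exists U, M = U *m S.
Proof.
move=> MS; have /all_sig[f fM] : forall i, {w | row i M = w *m S}.
  move=> i; apply: cid; apply: MS; exists (delta_mx 0 i); exact: rowE.
by exists (\matrix_i f i); apply/row_matrixP => i; rewrite row_mul rowK.
Qed.

(** The constant matrix [N] witnesses that the row degrees of [S] are reduced. *)
Lemma constraint_length_min (F : finFieldType) m n (S : 'M[{poly F}]_(m, n))
    (N : 'M[F]_(n, m)) :
  basic S -> (constraint_length S < size (\det (S *m map_mx polyC N)))%N ->
  forall p (M : 'M[{poly F}]_(p, n)), basic M ->
    (forall u, row_module M u <-> row_module S u) ->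
  (constraint_length S <= constraint_length M)%N.
Proof.
move=> [S' SS'] cS p M [M' MM'] eqMS.
have [U MU] : exists U, M = U *m S by apply: row_module_factor => u /eqMS.
have [V SV] : exists V, S = V *m M by apply: row_module_factor => u /eqMS.
(* The right inverse of [M] cancels [M] from [U *m V *m M = M]; likewise for [S] below. *)
have UV : U *m V = 1%:M.
  transitivity (U *m V *m (M *m M')); first by rewrite MM' mulmx1.
  by rewrite mulmxA -(mulmxA U) -SV -MU.
have VU : V *m U = 1%:M.
  transitivity (V *m U *m (S *m S')); first by rewrite SS' mulmx1.
  by rewrite mulmxA -(mulmxA V) -MU -SV.
have mp : p = m by apply/eqP; rewrite eqn_leq (mulmx1_min UV) (mulmx1_min VU).
case: m / mp in S S' N SS' cS eqMS U MU V SV UV VU *.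
rewrite -ltnS (leq_trans cS) // (leq_trans _ (size_det_constraint_length M N)) //.
(* The determinants for [M] and [S] differ by the factor [\det U], which is nonzero and so cannot
   lower the degree. *)
rewrite MU -mulmxA det_mulmx mulrC.
have [->|dS] := eqVneq (\det (S *m map_mx polyC N)) 0; first by rewrite size_poly0.
have dU : \det U != 0.
  by apply/eqP => dU; have /eqP := congr1 determinant UV;
     rewrite det_mulmx dU mul0r det1 eq_sym oner_eq0.
by rewrite size_mul // -subn1 -addnBA ?leq_addr ?size_poly_gt0.
Qed.

(** * Assembling a code from its two blocks *)

Lemma css_constraint_length (F : finFieldType) r s n
    (A : 'M[{poly F}]_(r, n)) (B : 'M[{poly F}]_(s, n)) :
  constraint_length (css_matrix A B) = (constraint_length A + constraint_length B)%N.
Proof.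
rewrite /constraint_length big_split_ord /=; congr (_ + _)%N; apply: eq_bigr => i _.
  rewrite /row_degree big_split_ord /= [X in maxn _ X]big1 => [|j _].
    by rewrite maxn0; apply: eq_bigr => j _; rewrite block_mxEul.
  by rewrite block_mxEur mxE size_poly0.
rewrite /row_degree big_split_ord /= [X in maxn X _]big1 => [|j _].
  by rewrite max0n; apply: eq_bigr => j _; rewrite block_mxEdr.
by rewrite block_mxEdl mxE size_poly0.
Qed.

Lemma css_basic (F : finFieldType) r s n
    (A : 'M[{poly F}]_(r, n)) (B : 'M[{poly F}]_(s, n)) :
  basic A -> basic B -> basic (css_matrix A B).
Proof.
move=> [A' AA'] [B' BB']; exists (block_mx A' 0 0 B').
by rewrite mulmx_block AA' BB' !mul0mx !mulmx0 !addr0 !add0r -scalar_mx_block.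
Qed.

(** The determinant identity serves twice: with the bound on the constraint lengths it makes the
    degree exactly [d], and it certifies minimality. *)
Lemma aqcc_exists (F : finFieldType) r s n d (A : 'M[{poly F}]_(r, n)) (B : 'M[{poly F}]_(s, n))
    (NA : 'M[F]_(n, r)) (NB : 'M[F]_(n, s)) (bB bA : nat) :
  basic A -> basic B -> mul_recip_tr A B = 0 ->
  (constraint_length A + constraint_length B <= d)%N ->
  \det (A *m map_mx polyC NA) * \det (B *m map_mx polyC NB) = 'X^d ->
  (forall u, edual (row_module B) u -> ~ row_module A u -> (bB <= weight u)%N) ->
  (forall u, edual (row_module A) u -> ~ row_module B u -> (bA <= weight u)%N) ->
  exists (Q : aqcc F n) (mu : nat) (dz dx : \bar int),
    aqcc_has_params Q (n%:Z - r%:Z - s%:Z) mu d dz dx /\ distance_bounds dz dx bB bA.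
Proof.
move=> bsA bsB oAB cAB dAB wB wA.
pose N := block_mx NA 0 0 NB.
have dN : \det (css_matrix A B *m map_mx polyC N) = 'X^d.
  rewrite map_block_mx !map_mx0 mulmx_block !mulmx0 !mul0mx !addr0 !add0r.
  by rewrite det_ublock.
have cd : constraint_length (css_matrix A B) = d.
  apply/eqP; rewrite eqn_leq {1}css_constraint_length cAB /=.
  by rewrite -ltnS -(size_polyXn F d) -dN size_det_constraint_length.
have cmin := @constraint_length_min _ _ _ (css_matrix A B) N (css_basic bsA bsB).
rewrite dN cd size_polyXn leqnn in cmin.
have {}cmin m (M : 'M[{poly F}]_(m, n + n)) : basic M ->
    (forall u, row_module M u <-> row_module (css_matrix A B) u) ->
    (constraint_length (css_matrix A B) <= constraint_length M)%N.
  by rewrite cd; apply: cmin.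
pose Q := AQCC (css_basic bsA bsB) oAB cmin.
exists Q, (aqcc_memory Q), (aqcc_dz Q), (aqcc_dx Q); split; first by split.
have QB : (bB%:Z%:E <= aqcc_wtB Q)%E by apply: min_weight_ge => u [/wB].
have QA : (bA%:Z%:E <= aqcc_wtA Q)%E by apply: min_weight_ge => u [/wA].
(* Each bound holds for one of the two weights, so the maximum dominates the larger bound and the
   minimum dominates the smaller. *)
rewrite /distance_bounds /aqcc_dz /aqcc_dx !le_max !le_min QA QB ?orbT /=.
case: ifPn => [AB|]; [split => //|rewrite -ltnNge => /ltnW BA; split => //].
  by rewrite andbT (le_trans _ QB) // lee_fin lez_nat.
by rewrite (le_trans _ QA) // lee_fin lez_nat.
Qed.

(** * Twisting a constant basis by a power of [D] *)

Section Twist.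
Variables (F : finFieldType) (n s : nat) (E : 'M[F]_n) (e : nat).
Hypothesis lt_s_n : (s.+1 < n)%N.

Let low : 'I_s.+1 -> 'I_n := widen_ord (ltnW lt_s_n).
Let high : 'I_n := Ordinal lt_s_n.

(** Rows [E_0 + D^e E_(s+1), E_1, ..., E_s]. *)
Definition twist_mx : 'M[{poly F}]_(s.+1, n) :=
  \matrix_(i, j) ((E (low i) j)%:P + (E high j *+ (i == 0))%:P * 'X^e).

(** Coordinates of the rows of [twist_mx] with respect to the rows of [E]; all dependence on [D]
    sits in this factor. *)
Definition twist_coef : 'M[{poly F}]_(s.+1, n) :=
  \matrix_(i, j) ((low i == j)%:R + ((i == 0) && (high == j))%:R * 'X^e).

Lemma twist_mxE : twist_mx = twist_coef *m map_mx polyC E.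
Proof.
have sumE (c : 'I_n) j : \sum_l (c == l)%:R * (E l j)%:P = (E c j)%:P.
  rewrite (bigD1 c) //= eqxx mul1r big1 ?addr0 // => l.
  by rewrite eq_sym => /negPf->; rewrite mul0r.
apply/matrixP => i j; rewrite !mxE.
under eq_bigr do rewrite !mxE mulrDl mulrAC.
rewrite big_split /= sumE -mulr_suml; congr (_ + _ * _).
case: (i == 0); first by rewrite sumE.
by rewrite big1 // => l _; rewrite mul0r.
Qed.

Lemma twist_coef0 i j : (0 < e)%N -> (twist_mx i j)`_0 = E (low i) j.
Proof. by move=> e0; rewrite mxE coefD coefMXn e0 addr0 coefC. Qed.

Let low_inj : injective low.
Proof. by move=> i l /(congr1 val) /= /val_inj. Qed.

Let high_low l : (high == low l) = false.
Proof. by rewrite -(inj_eq val_inj) gtn_eqF /=. Qed.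

(** The power of [D] occurs in column [high] only, so the [low] columns supply a constant right
    inverse. *)
Lemma twist_colsub_low : twist_coef *m map_mx polyC (colsub low 1%:M) = 1%:M.
Proof.
rewrite map_mxsub map_mx1 mulmx_colsub mulmx1; apply/matrixP => i l.
by rewrite !mxE high_low andbF mul0r addr0 (inj_eq low_inj).
Qed.

(** Trading column [low 0] for [high] moves [D^e] onto the diagonal, which yields the determinant
    needed for minimality. *)
Lemma twist_colsub_high (h := fun i : 'I_s.+1 => if i == 0 then high else low i) :
  twist_coef *m map_mx polyC (colsub h 1%:M) =
    diag_mx (\row_i (if i == 0 then 'X^e else 1)).
Proof.
rewrite map_mxsub map_mx1 mulmx_colsub mulmx1; apply/matrixP => i l.
rewrite !mxE /h; have [->|l0] := eqVneq l 0.
  rewrite eqxx andbT [_ == high]eq_sym high_low add0r.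
  by case: (i == 0); rewrite ?mul1r ?mul0r.
rewrite high_low andbF mul0r addr0 (inj_eq low_inj).
by have [->|il] := eqVneq i l; rewrite ?(negPf l0).
Qed.

Hypothesis E_unit : E \in unitmx.

Lemma twist_basic : basic twist_mx.
Proof.
exists (map_mx polyC (invmx E *m colsub low 1%:M)).
rewrite twist_mxE map_mxM mulmxA -[X in X *m _]mulmxA -map_mxM mulmxV // map_mx1 mulmx1.
exact: twist_colsub_low.
Qed.

Lemma twist_det : exists N, \det (twist_mx *m map_mx polyC N) = 'X^e.
Proof.
exists (invmx E *m colsub (fun i : 'I_s.+1 => if i == 0 then high else low i) 1%:M).
rewrite twist_mxE map_mxM mulmxA -[X in X *m _]mulmxA -map_mxM mulmxV // map_mx1 mulmx1.
rewrite twist_colsub_high det_diag big_ord_recl mxE eqxx big1 ?mulr1 // => i _.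
by rewrite mxE.
Qed.

Lemma twist_constraint_length : (constraint_length twist_mx <= e)%N.
Proof.
rewrite /constraint_length big_ord_recl big1 ?addn0 => [|i _].
  apply/bigmax_leqP => j _; rewrite mxE eqxx.
  rewrite -subn1 leq_subLR add1n (leq_trans (size_polyD _ _)) // geq_max.
  rewrite (leq_trans (size_polyC_leq1 _)) //=.
  by rewrite mul_polyC (leq_trans (size_scale_leq _ _)) ?size_polyXn.
rewrite /row_degree big1 // => j _.
by rewrite mxE mulr0n mul0r addr0 size_polyC; case: (_ != 0).
Qed.

(** As [E] is constant, inverting [D] affects only the factor [D^e], and the pairing is read off the
    products [UE] with the rows of [E]. *)
Lemma twist_recip m (U : 'M[{poly F}]_(m, n)) (UE := U *m (map_mx polyC E)^T) i l :
  mul_recip_tr U twist_mx i l =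
  tofrac (UE i (low l)) + tofrac (UE i high *+ (l == 0)) / tofrac 'X ^+ e.
Proof.
have UEE c : UE i c = \sum_j U i j * (E c j)%:P.
  by rewrite mxE; apply: eq_bigr => j _; rewrite !mxE.
rewrite mul_recip_trE !UEE -sumrMnl !rmorph_sum mulr_suml -big_split.
apply: eq_bigr => j _ /=.
rewrite mxE recipD recipM !recipC polyCMn -mulrnAr !tofracM mulrDr mulrA; congr (_ + _ * _).
elim: e => [|e' IH]; first by rewrite !expr0 invr1 recipC tofrac1.
by rewrite exprS recipM recipX IH exprS invfM.
Qed.
End Twist.

(** * The two constructions: positive rate and rate zero *)

Lemma aqcc_GRS (F : finFieldType) (n k t : nat) (zeta : 'I_n -> F) :
  injective zeta -> (k + t.+1 < n)%N ->
  exists (Q : aqcc F n) (mu : nat) (dz dx : \bar int),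
    aqcc_has_params Q (n%:Z - k%:Z - t.+1%:Z) mu 2 dz dx /\
    distance_bounds dz dx t.+2 k.+1.
Proof.
move=> zeta_inj ktn.
have lt_t_n : (t.+1 < n)%N by lia.
have le_k_n : (k <= n)%N by lia.
have [w w0 wzeta] := GRS_dual_multipliers zeta_inj (leq_ltn_trans (leq0n _) lt_t_n).
pose G := GRS_mx zeta (fun=> 1); pose H := GRS_mx zeta w.
have G_unit : G \in unitmx by apply: GRS_mx_unit => // j; apply: oner_neq0.
have H_unit : H \in unitmx by apply: GRS_mx_unit.
pose A0 := rowsub (widen_ord le_k_n) G; pose A := map_mx polyC A0.
pose N := colsub (widen_ord le_k_n) (invmx G).
have A0N : A0 *m N = 1%:M.
  rewrite /A0 /N -mxsub_mul mulmxV //; apply/matrixP => i l.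
  by rewrite !mxE -(inj_eq val_inj).
have AN : A *m map_mx polyC N = 1%:M by rewrite -map_mxM A0N map_mx1.
have [NB BNB] := twist_det 2 lt_t_n H_unit.
have AH i (c : 'I_n) : (c <= t.+1)%N -> (A *m (map_mx polyC H)^T) i c = 0.
  move=> ct; suff h : (A0 *m H^T) i c = 0 by rewrite map_trmx -map_mxM mxE h.
  rewrite mxE.
  (* The exponent [i + c] is at most [k + t], which [ktn] keeps below [n - 1]; the case [c = t + 1]
     is the row attached to [D^2]. *)
  rewrite -[RHS](wzeta (i + c)%N); last by have := ltn_ord i; lia.
  by apply: eq_bigr => j _; rewrite !mxE mul1r exprD mulrCA.
apply: (@aqcc_exists _ _ _ _ _ A (twist_mx H 2 lt_t_n) N NB).
- by exists (map_mx polyC N).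
- exact: twist_basic.
- apply/matrixP => i l; rewrite twist_recip !AH ?mxE //=; last by have := ltn_ord l; lia.
  by rewrite mul0rn !rmorph0 mul0r addr0.
- rewrite (leq_trans _ (twist_constraint_length H 2 lt_t_n)) // -[leqRHS]add0n leq_add2r.
  rewrite leqn0; apply/eqP/big1 => i _; apply: big1 => j _.
  by rewrite mxE size_polyC; case: (_ != 0).
- by rewrite AN BNB det1 mul1r.
(* The constant terms of the twisted rows are the first [t + 1] rows of [H]; [u] is nonzero because
   0 lies in the row module of [A]. *)
- move=> u uB uA; apply: (weight_edual_GRS zeta_inj w0 _ uB) => [i j|].
    by rewrite twist_coef0 // mxE.
  by apply/eqP => u0; apply: uA; exists 0; rewrite mul0mx.
move=> u uA uB; apply: (weight_edual_GRS (w := fun=> 1) zeta_inj _ _ uA) => [j|i j|].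
- exact: oner_neq0.
- by rewrite !mxE coefC.
by apply/eqP => u0; apply: uB; exists 0; rewrite mul0mx.
Qed.

(** Both minimum weights are taken over empty sets, hence infinite, so [bz] and [bx] may be
    arbitrary. *)
Lemma aqcc_rate_zero (F : finFieldType) (s bz bx : nat) :
  exists (Q : aqcc F s.+2) (mu : nat) (dz dx : \bar int),
    aqcc_has_params Q (s.+2%:Z - 1%:Z - s.+1%:Z) mu 2 dz dx /\ distance_bounds dz dx bz bx.
Proof.
pose A : 'rV[{poly F}]_s.+2 := \row_j ((j == 0)%:R%:P + (- (j == ord_max)%:R)%:P * 'X).
have lt_s : (s.+1 < s.+2)%N by [].
pose B := twist_mx (1%:M : 'M[F]_s.+2) 1 lt_s.
have [NB BNB] := twist_det 1 lt_s (unitmx1 F s.+2).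
pose low := widen_ord (ltnW lt_s).
have highE : Ordinal lt_s = ord_max by apply: val_inj.
have B_recip m (U : 'M[{poly F}]_(m, s.+2)) i l : mul_recip_tr U B i l =
    tofrac (U i (low l)) + tofrac (U i ord_max *+ (l == 0)) / tofrac 'X.
  by rewrite /B twist_recip map_mx1 trmx1 mulmx1 highE expr1.
have lowE l : (low l == 0) = (l == 0) by [].
have low_max l : (low l == ord_max) = false.
  by rewrite -(inj_eq val_inj) ltn_eqF /=.
have max0 : (ord_max == 0 :> 'I_s.+2) = false by [].
have lowP j : j != ord_max -> exists l, j = low l.
  move=> jm; have lt_js : (j < s.+1)%N.
    by rewrite ltn_neqAle -ltnS ltn_ord andbT; apply: contra jm => /eqP jm; apply/eqP/val_inj.
  by exists (Ordinal lt_js); apply: val_inj.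
have A_low l : A 0 (low l) = (l == 0)%:R%:P.
  by rewrite mxE lowE low_max oppr0 polyC0 mul0r addr0.
have low0 : low 0 = 0 by apply: val_inj.
have A_0 : A 0 0 = 1 by rewrite -[X in A 0 X]low0 A_low.
have A_max : A 0 ord_max = - 'X by rewrite mxE max0 eqxx add0r polyCN mulN1r.
have X0 := tofracX_neq0 F.
(* The witness selects the last entry [-D] of [A] and changes its sign; each block then contributes
   one factor [D] to the determinant. *)
apply: (@aqcc_exists _ _ _ _ _ A B (- delta_mx ord_max 0) NB).
- exists (delta_mx 0 0); apply/matrixP => i j; rewrite !ord1 -colE mxE.
  by rewrite A_0 !mxE.
- exact: twist_basic (unitmx1 _ _).
- apply/matrixP => i l; rewrite ord1 B_recip [RHS]mxE A_low A_max.
  case: (l == 0) => /=; last by rewrite mulr0n polyC0 !rmorph0 mul0r addr0.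
  by rewrite mulr1n rmorphN rmorph1 mulNr divff // subrr.
- rewrite -[2%N]/(1 + 1)%N leq_add ?twist_constraint_length //.
  rewrite /constraint_length big_ord1; apply/bigmax_leqP => j _.
  rewrite mxE -subn1 leq_subLR (leq_trans (size_polyD _ _)) // geq_max.
  rewrite (leq_trans (size_polyC_leq1 _)) //= mul_polyC.
  by rewrite (leq_trans (size_scale_leq _ _)) ?size_polyX.
- rewrite BNB map_mxN map_delta_mx mulmxN -colE.
  by rewrite [\det (- _)]det_mx11 !mxE -/(A 0 ord_max) max0 eqxx add0r polyCN mulN1r opprK.
(* Duality with [B] kills the middle entries and makes the last entry [-D] times the first, so [u]
   is its first entry times [A]. *)
- move=> u /edual_row_module/rowP uB []; exists (u 0 0)%:M.
  have u_low l : tofrac (u 0 (low l)) + tofrac (u 0 ord_max *+ (l == 0)) / tofrac 'X = 0.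
    by rewrite -B_recip uB mxE.
  apply/rowP => j; rewrite mul_scalar_mx mxE.
  have [->|/lowP[l ->]] := eqVneq j ord_max.
    rewrite A_max mulrN; apply/eqP; rewrite -tofrac_eq tofracN tofracM.
    have := u_low 0; rewrite mulr1n => /eqP; rewrite addr_eq0 => /eqP.
    by rewrite low0 => ->; rewrite mulNr divfK // opprK.
  rewrite A_low; have := u_low l; have [->|l0] := eqVneq l 0.
    by rewrite low0 mulr1.
  by move/eqP; rewrite mulr0n tofrac0 mul0r addr0 tofrac_eq0 => /eqP->; rewrite polyC0 mulr0.
(* Duality with [A] makes the last entry [D] times the first, so the other entries of [u] are its
   coordinates on the rows of [B]. *)
move=> u /edual_row_module/rowP/(_ 0); rewrite mul_recip_trE mxE => uA [].
exists (\row_i u 0 (low i)).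
have {}uA : tofrac (u 0 0) = tofrac (u 0 ord_max) / tofrac 'X.
  apply/eqP; rewrite -subr_eq0; apply/eqP; rewrite -[RHS]uA.
  rewrite (bigD1 0) // (bigD1 ord_max) //= big1 ?addr0 => [|j /andP[j0 jm]].
    rewrite A_max A_0 recipC tofrac1 mulr1; congr (_ + _).
    rewrite (_ : - 'X = (-1)%:P * 'X); last by rewrite polyCN mulN1r.
    by rewrite recipM recipC recipX polyCN tofracN tofrac1 mulN1r mulrN.
  by rewrite mxE (negPf j0) (negPf jm) oppr0 polyC0 mul0r addr0 recip0 mulr0.
have {}uA : u 0 ord_max = u 0 0 * 'X.
  by apply/eqP; rewrite -tofrac_eq tofracM uA divfK.
apply/rowP => j; rewrite mxE.
have BE i c : B i c = (low i == c)%:R%:P + ((ord_max == c)%:R *+ (i == 0))%:P * 'X.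
  by rewrite !mxE highE expr1.
have [->|/lowP[l jl]] := eqVneq j ord_max.
  rewrite (bigD1 0) //= big1 ?addr0 => [|i /negPf i0]; rewrite mxE BE low_max add0r.
    by rewrite low0 eqxx mulr1n mul1r.
  by rewrite i0 mulr0n polyC0 mul0r mulr0.
rewrite (bigD1 l) //= big1 ?addr0 => [|i il]; rewrite mxE BE jl.
  by rewrite eqxx [ord_max == _]eq_sym low_max mul0rn polyC0 mul0r addr0 mulr1.
rewrite [ord_max == _]eq_sym low_max mul0rn polyC0 mul0r addr0.
by rewrite -(inj_eq val_inj) /= (inj_eq val_inj) (negPf il) mulr0.
Qed.

Theorem theorem3p10 (q : nat) (F : finFieldType) (hF : #|F| = q) (hq : (5 <= q)%N)
    (k n : nat) (hk : (1 <= k)%N) (hn : (5 <= n)%N)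
    (hnq : (n <= q)%N) (hkn : (k <= n - 4)%N)
    (zeta : n.-tuple F) (hzeta : uniq zeta)
    (v : n.-tuple F) (hv : forall i : 'I_n, tnth v i != 0)
    (t : nat) (ht1 : (1 <= t)%N) (ht2 : (t <= n - k - 1)%N) :
  exists (Q : aqcc F n) (mu : nat) (dz dx : \bar int),
    aqcc_has_params Q (n%:Z - t%:Z - k%:Z - 1) mu 2 dz dx /\
    distance_bounds dz dx (t + 2) (k + 1).
Proof.
have zeta_inj : injective (tnth zeta) by apply/tuple_uniqP.
have [ltn|gen] := ltnP (k + t.+1) n.
  rewrite addn1 addn2 (_ : n%:Z - t%:Z - k%:Z - 1 = n%:Z - k%:Z - t.+1%:Z); last by lia.
  exact: aqcc_GRS zeta_inj ltn.
(* With [ht2] only [k + t + 1 = n] remains, where there are no logical qudits. *)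
have [s ns] : exists s, n = s.+2 by exists n.-2; lia.
rewrite (_ : n%:Z - t%:Z - k%:Z - 1 = n%:Z - 1%:Z - s.+1%:Z); last by lia.
rewrite ns.
exact: aqcc_rate_zero.
Qed.
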